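(* Let $N\geq 1$ and $M\geq 2$ be integers. The directed graph $G(N,M)$ is strongly connected if and only if $M\geq N+1$.
   Context: For a positive integer $K$ write $[K]=\{1,\ldots,K\}$. For integers $N\geq 1$, $M\geq 2$, let $V=\{f:[N]\to[M]\}$ be the set of all functions (called configurations of $N$ people in $M$ rooms) and let $E\subseteq V\times V$ be the set of pairs $(f,g)$ such that for all $k\in[N]$: $g(k)\neq f(k)$ if and only if $k=\max f^{-1}(f(k))$. (That is, exactly the largest-numbered, i.e. smartest, person in each occupied room changes room.) Then $G(N,M)=(V,E)$ is a directed graph. *)

(* Defs.v *)
From mathcomp Require Import all_boot.

Set Implicit Arguments.
Unset Strict Implicit.
Unset Printing Implicit Defensive.

(* People [N] and rooms [M] are numbered from 0; only the order on people
   matters, so the shift is harmless. *)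
Definition config (N M : nat) := {ffun 'I_N -> 'I_M}.

(* The \max ranges over the fibre of f through k, which contains k, so its
   default value 0 on an empty range never occurs. *)
Definition smartest (N M : nat) (f : config N M) (k : 'I_N) : bool :=
  k == \max_(j in f @^-1: [set f k]) j :> nat.

Definition edge (N M : nat) : rel (config N M) :=
  fun f g => [forall k : 'I_N, (g k != f k) == smartest f k].

Definition strongly_connected (V : finType) (e : rel V) : Prop :=
  forall x y : V, connect e x y.

(* Main.v *)
Require Import Defs.
From mathcomp Require Import all_boot.

(** The people above a given one evolve on their own: person [k] moves exactly
    when no higher person shares the room, whatever the lower people do.

    If [M <= N], gathering everybody in one room [r] is impossible
    ([edge_to_gathered]): a person staying put would already be in [r], but the
    smartest occupant of [r] has to leave it; hence everybody moves, from
    pairwise distinct rooms other than [r], and there are only [M - 1] of those.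

    If [N < M], strong connectivity follows by induction on [N], adding a new
    lowest person 0 who moves exactly when alone ([edge_add_lowest]).  A walk of
    the other people exists by induction, and at any time they leave at least
    two rooms empty; so person 0, once alone, can keep jumping to a room which is
    empty at the next step ([walk_alone]).  Likewise, backwards in time, any
    final room of person 0 can be reached along any walk of the others, from some
    starting room ([walk_from_somewhere]).  What remains is to make person 0
    forget where he was, i.e. to reach every room while the others do the same
    thing ([forget_lowest]): bring the others into pairwise distinct rooms with
    person 0 alone in [s]; all the others then enter [s] while person 0 leaves
    for an arbitrary room other than [s]; being alone there, he can leave it
    again for an arbitrary room. *)

(** * Moves *)

Lemma smartestP {N M : nat} (f : config N M) (k : 'I_N) :
  reflect (forall j, f j = f k -> j <= k) (smartest f k).
Proof.
apply: (iffP eqP) => [-> j fj | le_k].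
  by apply: (@leq_bigmax_cond _ _ (fun j : 'I_N => j : nat)); rewrite !inE fj.
apply/eqP; rewrite eqn_leq; apply/andP; split.
  by apply: (@leq_bigmax_cond _ _ (fun j : 'I_N => j : nat)); rewrite !inE.
by apply/bigmax_leqP => j; rewrite !inE => /eqP; apply: le_k.
Qed.

Lemma smartest_in_room {N M : nat} (f : config N M) (j : 'I_N) :
  exists2 k, smartest f k & f k = f j.
Proof.
case: (@arg_maxnP _ j (fun i => f i == f j) val (eqxx _)) => k /eqP fk max_k.
by exists k => //; apply/smartestP => i; rewrite fk => /eqP; apply: max_k.
Qed.

Lemma smartest_inj {N M : nat} (f : config N M) :
  injective f <-> forall k, smartest f k.
Proof.
split=> [inj_f k | all_f i j fij].
  by apply/smartestP => j /inj_f ->.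
by apply/val_inj/eqP; rewrite eqn_leq !(smartestP _ _ (all_f _)).
Qed.

Lemma edge_total {N m : nat} (f : config N m.+2) : exists g, edge f g.
Proof.
exists [ffun k => if smartest f k then lift (f k) ord0 else f k].
apply/forallP => k; rewrite ffunE; case: ifP => _; last by rewrite eqxx.
by rewrite eqb_id eq_sym neq_lift.
Qed.

Lemma edge_to_gathered {N M : nat} (f : config N M) (r : 'I_M) :
  edge f [ffun=> r] -> N < M.
Proof.
move=> /forallP efr.
have fr j : f j != r.
  apply/eqP => fj; have [k sk fk] := smartest_in_room f j.
  by have := efr k; rewrite ffunE fk fj eqxx sk.
have inj_f : injective f.
  apply/smartest_inj => k; have := efr k.
  by rewrite ffunE (eq_sym r) fr => /eqP <-.
have : #|codom f| <= #|predC1 r|.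
  by apply/subset_leq_card/subsetP => _ /codomP [j ->]; rewrite !inE fr.
rewrite (card_codom inj_f) cardC1 !card_ord.
by move=> /leq_ltn_trans; apply; rewrite ltn_predL (leq_ltn_trans _ (ltn_ord r)).
Qed.

Lemma gather {N M : nat} (h : config N M) (s : 'I_M) :
  injective h -> s \notin codom h -> edge h [ffun=> s].
Proof.
move=> /smartest_inj all_h sh; apply/forallP => k.
rewrite ffunE all_h eqb_id; apply: contraNneq sh => ->; exact: codom_f.
Qed.

(** * Adding a lowest person *)

Definition add_lowest {N M : nat} (a : 'I_M) (f : config N M) : config N.+1 M :=
  [ffun k => oapp f a (unlift ord0 k)].

Lemma add_lowest0 {N M : nat} (a : 'I_M) (f : config N M) :
  add_lowest a f ord0 = a.
Proof. by rewrite ffunE unlift_none. Qed.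

Lemma add_lowestS {N M : nat} (a : 'I_M) (f : config N M) j :
  add_lowest a f (lift ord0 j) = f j.
Proof. by rewrite ffunE liftK. Qed.

Lemma add_lowest_surj {N M : nat} (f : config N.+1 M) :
  exists a, exists f', f = add_lowest a f'.
Proof.
exists (f ord0), [ffun j => f (lift ord0 j)]; apply/ffunP => k.
case: (unliftP ord0 k) => [j|] ->; first by rewrite add_lowestS ffunE.
by rewrite add_lowest0.
Qed.

Lemma smartest_lowest {N M : nat} (a : 'I_M) (f : config N M) :
  smartest (add_lowest a f) ord0 = (a \notin codom f).
Proof.
apply/smartestP/idP => [le0 | af k].
  apply/negP => /codomP [j fj].
  by have := le0 (lift ord0 j); rewrite add_lowestS add_lowest0 => /(_ (esym fj)).
case: (unliftP ord0 k) => [j|] -> //.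
by rewrite add_lowestS add_lowest0 => fj; rewrite -fj codom_f in af.
Qed.

Lemma smartest_add_lowest {N M : nat} (a : 'I_M) (f : config N M) j :
  smartest (add_lowest a f) (lift ord0 j) = smartest f j.
Proof.
apply/smartestP/smartestP => le_j i.
  by move=> fij; apply: (le_j (lift ord0 i)); rewrite !add_lowestS.
case: (unliftP ord0 i) => [i'|] -> //.
by rewrite !add_lowestS; apply: le_j.
Qed.

Lemma edge_add_lowest {N M : nat} (a b : 'I_M) (f g : config N M) :
  edge (add_lowest a f) (add_lowest b g) =
  edge f g && ((b != a) == (a \notin codom f)).
Proof.
apply/forallP/andP => [e | [/forallP e e0] k].
  split; last by have := e ord0; rewrite !add_lowest0 smartest_lowest.
  apply/forallP => j; have := e (lift ord0 j).
  by rewrite !add_lowestS smartest_add_lowest.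
case: (unliftP ord0 k) => [j|] ->; last by rewrite !add_lowest0 smartest_lowest.
by rewrite !add_lowestS smartest_add_lowest.
Qed.

Lemma edge_alone {N M : nat} {a b : 'I_M} {f g : config N M} :
  edge f g -> a \notin codom f -> b != a ->
  connect (@edge _ _) (add_lowest a f) (add_lowest b g).
Proof. by move=> e af ba; apply: connect1; rewrite edge_add_lowest e af ba. Qed.

(** * Controlling the lowest person *)

Lemma another_empty_room {N M : nat} (f : config N M) (y : 'I_M) :
  N.+1 < M -> exists2 a, a \notin codom f & a != y.
Proof.
move=> NM; have /card_gt0P [a] : 0 < #|[predC [predU1 y & codom f]]|.
  rewrite -(ltn_add2l #|[predU1 y & codom f]|) cardC addn0 card_ord cardU1.
  apply: leq_ltn_trans NM; rewrite -add1n leq_add ?leq_b1 //.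
  by rewrite (leq_trans (leq_image_card _ _)) ?card_ord.
by rewrite !inE negb_or => /andP [ay af]; exists a.
Qed.

(** Person 0 waits in [a] until [a] is empty of others, and then moves at every
    step to a room which the others leave empty. *)
Lemma walk_alone {N M : nat} (f g : config N M) (a : 'I_M) :
  N.+1 < M -> connect (@edge _ _) f g ->
  (a \notin codom f) || (a \notin codom g) ->
  exists2 b, b \notin codom g &
    connect (@edge _ _) (add_lowest a f) (add_lowest b g).
Proof.
move=> NM /connectP [p pf ->] {g}.
elim: p f a pf => [|h p IHp] f a /=; first by rewrite orbb => _ af; exists a.
case/andP=> efh ph; have [af _ | af /= ag] := boolP (a \notin codom f).
  have [b bh ba] := another_empty_room h a NM.
  have [|c cg bc] := IHp h b ph; first by rewrite bh.
  by exists c => //; apply: connect_trans bc; apply: edge_alone.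
have [|c cg ac] := IHp h a ph; first by rewrite ag orbT.
exists c => //; apply: connect_trans ac; apply: connect1.
by rewrite edge_add_lowest efh (negPf af) eqxx.
Qed.

(** Choosing the rooms of person 0 backwards in time: before being in [z],
    person 0 can have been alone in an empty room other than [z]. *)
Lemma walk_from_somewhere {N M : nat} (f g : config N M) (b : 'I_M) :
  N.+1 < M -> connect (@edge _ _) f g ->
  exists a, connect (@edge _ _) (add_lowest a f) (add_lowest b g).
Proof.
move=> NM /connectP [p pf ->] {g}.
elim: p f pf => [|h p IHp] f /=; first by exists b.
case/andP=> efh /IHp [z zb]; have [a af az] := another_empty_room f z NM.
exists a; apply: connect_trans zb; apply: edge_alone => //.
by rewrite eq_sym.
Qed.

Lemma injective_config_avoiding {N M : nat} (a : 'I_M) :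
  N < M -> exists2 h : config N M, injective h & a \notin codom h.
Proof.
case: M a => [[]//|m] a; rewrite ltnS => Nm.
exists [ffun i => lift a (widen_ord Nm i)].
  by move=> i j; rewrite !ffunE => /lift_inj /(congr1 val) /= /val_inj.
by apply/codomP => -[i]; rewrite ffunE; apply/eqP/neq_lift.
Qed.

(** Two consecutive free jumps of person 0 are needed: the first cannot end in
    [s], but this is the room into which everybody else has just moved, so two
    or more rooms remain from which person 0 makes the second one. *)
Lemma forget_lowest {N M : nat} (f : config N M) (a : 'I_M) :
  0 < N -> N.+1 < M -> strongly_connected (@edge N M) ->
  exists k : config N M, forall y,
    connect (@edge _ _) (add_lowest a f) (add_lowest y k).
Proof.
move=> N0 NM sc; have [h inj_h ah] := injective_config_avoiding a (ltnW NM).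
have [|s sh ash] := walk_alone f h a NM (sc f h); first by rewrite ah orbT.
have [k ek] : exists k, edge ([ffun=> s] : config N M) k.
  by case: (M) NM s {a f sc h inj_h ah sh ash} => [|[|m]] // _ s; apply: edge_total.
exists k => y; have [x xs xy] := another_empty_room [ffun=> s] y NM.
apply: connect_trans ash _; apply: connect_trans (edge_alone ek xs _).
  apply: edge_alone (gather h s inj_h sh) sh _.
  apply: contraNneq xs => ->; apply/codomP.
  by exists (Ordinal N0); rewrite ffunE.
by rewrite eq_sym.
Qed.

Lemma strongly_connected_edge {N M : nat} :
  N < M -> strongly_connected (@edge N M).
Proof.
elim: N => [|[|N] IHN] NM f g.
- by have -> : f = g by apply/ffunP => -[].
  (* A single person always moves, to any other room; [forget_lowest] needs
     somebody else, so this case starts the induction. *)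
- have [-> // | /eqP fg] := eqVneq f g; apply/connect1/forallP => k.
  have -> : smartest f k by apply/smartestP => j _; rewrite !ord1.
  rewrite eqb_id; apply/eqP => gk; case: fg; apply/ffunP => j.
  by rewrite !ord1 in gk *.
have [a [f' ->]] := add_lowest_surj f; have [b [g' ->]] := add_lowest_surj g.
have sc := IHN (ltnW NM).
have [k ak] := forget_lowest f' a (ltn0Sn N) NM sc.
have [y yb] := walk_from_somewhere k g' b NM (sc k g').
exact: connect_trans (ak y) yb.
Qed.

Theorem theorem1p1 (N M : nat) (hN : 1 <= N) (hM : 2 <= M) :
  strongly_connected (@edge N M) <-> N + 1 <= M.
Proof.
rewrite addn1; split; last exact: strongly_connected_edge.
move=> sc; pose r := Ordinal (ltnW hM); pose r' := Ordinal hM.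
(* A walk between distinct configurations has a last edge. *)
have /connectP [p] := sc [ffun=> r'] [ffun=> r].
case/lastP: p => [_ /ffunP /(_ (Ordinal hN)) | p g].
  by rewrite !ffunE => /(congr1 val).
rewrite rcons_path last_rcons => /andP [_ e] gr.
by move: e; rewrite -gr; apply: edge_to_gathered.
Qed.
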